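(* Let $k\ge 3$, let $C_k$ denote the cycle on $k$ vertices, and let $\Sigma$ be an arbitrary element of $\{0,1\}^k$. Then there exist a function $\tau:\mathbb{R}^+\to\mathbb{R}^+$ (not depending on $n$) and a $k$-query tester which, for every positive integer $n$, given oracle access to $f:\{0,1\}^n\to\{0,1\}$, accepts with probability $1$ if $f$ is $(C_k,\Sigma)$-free, and, for every $\epsilon>0$, rejects with probability at least $\tau(\epsilon)$ if $f$ is $\epsilon$-far from the family of $(C_k,\Sigma)$-free functions.
   Context: $\{0,1\}$ is identified with the field $\mathbb{F}_2$, and $\{0,1\}^n$ with the vector space $\mathbb{F}_2^n$; linear means $\mathbb{F}_2$-linear. The graphic matroid of $C_k$ is represented by vectors $v_1,\ldots,v_k\in\{0,1\}^k$ where $v_i=e_i$ (standard basis vector) for $i\le k-1$ and $v_k=e_1+\cdots+e_{k-1}$. A function $f:\{0,1\}^n\to\{0,1\}$ is $(C_k,\Sigma)$-free if for every linear map $L:\{0,1\}^k\to\{0,1\}^n$, $\langle f(L(v_1)),\ldots,f(L(v_k))\rangle\ne\Sigma$. (Equivalently: there are no $x_1,\ldots,x_k\in\{0,1\}^n$, not necessarily distinct, with $\sum_i x_i=0$ and $\langle f(x_1),\ldots,f(x_k)\rangle=\Sigma$.) For $f,g:\{0,1\}^n\to\{0,1\}$, $\delta(f,g)=\Pr_x[f(x)\ne g(x)]$ with $x$ uniform in $\{0,1\}^n$; $f$ is $\epsilon$-far from a family $\mathcal{F}$ if $\delta(f,g)\ge\epsilon$ for every $g\in\mathcal{F}$. A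 $k$-query tester is a randomized procedure that queries $f$ at (at most) $k$ points and then accepts or rejects. *)

(* Defs.v *)
From HB Require Import structures.
From mathcomp Require Import all_boot all_order all_algebra.
From mathcomp Require Import reals.

Set Implicit Arguments.
Unset Strict Implicit.
Unset Printing Implicit Defensive.

Import Order.TTheory GRing.Theory Num.Theory.
Local Open Scope ring_scope.

(* {0,1} is 'F_2 and {0,1}^n is 'rV['F_2]_n throughout. *)

Definition matroid_free (k n : nat) (v : 'I_k -> 'rV['F_2]_k)
    (Sigma : 'rV['F_2]_k) (f : 'rV['F_2]_n -> 'F_2) : Prop :=
  forall L : {linear 'rV['F_2]_k -> 'rV['F_2]_n},
    \row_(i < k) f (L (v i)) <> Sigma.

(* Indices start at 0: the last vector, of index k.-1, is the sum of the
   k.-1 standard basis vectors before it. *)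
Definition cycle_vec (k : nat) (i : 'I_k) : 'rV['F_2]_k :=
  if (i < k.-1)%N then delta_mx 0 i
  else \sum_(j < k | (j < k.-1)%N) delta_mx 0 j.

Definition cycle_free (k n : nat) (Sigma : 'rV['F_2]_k)
    (f : 'rV['F_2]_n -> 'F_2) : Prop :=
  matroid_free (@cycle_vec k) Sigma f.

Definition fdist (R : realType) (n : nat) (f g : 'rV['F_2]_n -> 'F_2) : R :=
  #|[set x | f x != g x]|%:R / #|{: 'rV['F_2]_n}|%:R.

Definition far_from (R : realType) (n : nat) (eps : R)
    (F : ('rV['F_2]_n -> 'F_2) -> Prop) (f : 'rV['F_2]_n -> 'F_2) : Prop :=
  forall g, F g -> eps <= fdist R f g.

(* Deterministic adaptive query strategies: each query may depend on the
   previous answers, and the final verdict is true for acceptance. *)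
Inductive strategy (n : nat) : Type :=
  | Verdict of bool
  | Query of 'rV['F_2]_n & ('F_2 -> strategy n).

Fixpoint run (n : nat) (f : 'rV['F_2]_n -> 'F_2) (s : strategy n) : bool :=
  match s with
  | Verdict b => b
  | Query x next => run f (next (f x))
  end.

Fixpoint num_queries (n : nat) (f : 'rV['F_2]_n -> 'F_2)
    (s : strategy n) : nat :=
  match s with
  | Verdict _ => 0
  | Query x next => (num_queries f (next (f x))).+1
  end.

(* A randomized procedure draws all its random coins first. Finitely many
   outcomes lose no generality, since for fixed k and n the strategies making
   at most k queries compute only finitely many accept/reject functions. *)
Record tester (R : realType) (k n : nat) : Type := Tester {
  coins : finType;
  prob : coins -> R;
  prob_ge0 : forall c, 0 <= prob c;
  prob_sum1 : \sum_c prob c = 1;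
  strategy_of : coins -> strategy n;
  query_bound : forall c f, (num_queries f (strategy_of c) <= k)%N
}.

Arguments coins {R k n} t.
Arguments prob {R k n} t c.
Arguments strategy_of {R k n} t c.

Definition accept_prob (R : realType) (k n : nat) (T : tester R k n)
    (f : 'rV['F_2]_n -> 'F_2) : R :=
  \sum_(c | run f (strategy_of T c)) prob T c.

Definition reject_prob (R : realType) (k n : nat) (T : tester R k n)
    (f : 'rV['F_2]_n -> 'F_2) : R :=
  \sum_(c | ~~ run f (strategy_of T c)) prob T c.

(* Main.v *)
Require Import Defs.
From HB Require Import structures.
From mathcomp Require Import all_boot all_order all_algebra.
From mathcomp Require Import reals boolp.
From mathcomp Require Import ring lra zify.

Set Implicit Arguments.
Unset Strict Implicit.
Unset Printing Implicit Defensive.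

Import Order.TTheory GRing.Theory Num.Theory.
Local Open Scope ring_scope.

(** The tester draws a uniformly random solution of x_1 + ... + x_k = 0 and
    rejects when the values of f along it spell out Sigma. It never rejects a
    free f, and its rejection probability is the density of such solutions, so
    everything rests on a removal lemma ([removal]): if few solutions carry
    the pattern Sigma, then f is close to a free function.

    By Fourier analysis on F_2^n, the density of solutions weighted by
    functions F_1, ..., F_k is the sum over characters g of the products of
    the Fourier coefficients of the F_i at g ([cycle_density_fourier]). Since
    k >= 3, two factors of each product can be spent on Parseval and one
    remains to be bounded in supremum. This gives the counting lemma
    ([coset_counting]): if cosets y_i + H of one subgroup satisfy y_1 + ... +
    y_k = 0 and on each of them F_i is Fourier-close to a constant not too
    near 0, then the solutions inside these cosets already have density
    bounded below in terms of the density of H. All subgroups used are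
    annihilators of boundedly many characters, so their density is bounded
    below independently of n.

    If Sigma is not constant, some value b occurs twice in Sigma and b + 1
    occurs as well. When one value of f is rare, f is close to a constant
    function, which is free. Otherwise let A be the indicator of f = b, of
    mean a, with Fourier coefficients A^(g). The coefficients at the three
    chosen positions are those of A, A and 1 - A, which makes the solution
    density at least a positive multiple of the sum of A^(g)^2 (a - |A^(g)|).
    If the density is small, nearly all of the L2-mass of A lies on the
    boundedly many characters with large coefficients, hence f is close to a
    function constant on cosets of their annihilator. That function must be
    free, or else the counting lemma would yield many solutions for f
    ([removal_mixed]).

    If Sigma is constant equal to b, an arithmetic regularity lemma
    ([regularity]) provides a subgroup H such that the indicator of f = b is
    Fourier-uniform on most cosets of H. Flipping f to b + 1 wherever it
    equals b on a coset that is not uniform, or on which b is rare, costs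
    little; any solution with pattern Sigma that survives lies in cosets to
    which the counting lemma applies ([removal_constant]). *)

(** * Fourier analysis on F_2^n *)

Lemma F2_cases (b : 'F_2) : b = 0 \/ b = 1.
Proof. by case: b => -[|[|]] // ?; [left|right]; apply/val_inj. Qed.

Lemma F2_addxx (b : 'F_2) : b + b = 0.
Proof. by case: (F2_cases b) => ->; apply/val_inj. Qed.

Lemma F2_neqE (a b : 'F_2) : (a != b) = (a == b + 1).
Proof. by case: (F2_cases a) => ->; case: (F2_cases b) => ->. Qed.

Section Fourier.
Variables (R : realType) (n : nat).
Local Notation V := 'rV['F_2]_n.
Implicit Types (F G : V -> R) (g x y a : V).

Lemma rowF2_addxx x : x + x = 0.
Proof.
apply/rowP => i; rewrite !mxE.
exact: F2_addxx.
Qed.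

Lemma rowF2_opp x : - x = x.
Proof. by apply/esym/eqP; rewrite -addr_eq0 rowF2_addxx. Qed.

Definition dot g x : 'F_2 := (g *m x^T) 0 0.

Lemma dotDl g1 g2 x : dot (g1 + g2) x = dot g1 x + dot g2 x.
Proof. by rewrite /dot mulmxDl mxE. Qed.

Lemma dotC g x : dot g x = dot x g.
Proof. by rewrite /dot -[g *m _]trmxK trmx_mul trmxK mxE. Qed.

Lemma dotDr g x y : dot g (x + y) = dot g x + dot g y.
Proof. by rewrite !(dotC g) dotDl. Qed.

Definition chi g x : R := (-1) ^+ dot g x.

Lemma chiC g x : chi g x = chi x g.
Proof. by rewrite /chi dotC. Qed.

Lemma chiDl g1 g2 x : chi (g1 + g2) x = chi g1 x * chi g2 x.
Proof.
rewrite /chi dotDl.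
by case: (F2_cases (dot g1 x)) => ->; case: (F2_cases (dot g2 x)) => ->;
  rewrite /= ?expr0 ?expr1 ?mulr1 ?mul1r ?mulrNN ?mulr1.
Qed.

Lemma chiDr g x y : chi g (x + y) = chi g x * chi g y.
Proof. by rewrite !(chiC g) chiDl. Qed.

Lemma normr_chi g x : `|chi g x| = 1.
Proof. by rewrite normrX normrN1 expr1n. Qed.

Lemma chi0l x : chi 0 x = 1.
Proof. by rewrite /chi /dot mul0mx mxE. Qed.

Lemma chi0r g : chi g 0 = 1.
Proof. by rewrite chiC chi0l. Qed.

Lemma chi_neq1 g x : chi g x != 1 -> chi g x = -1.
Proof. by rewrite /chi; case: (F2_cases (dot g x)) => ->;
  rewrite ?expr0 ?eqxx ?expr1. Qed.

Lemma chi_sum (I : finType) g (x : I -> V) :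
  chi g (\sum_i x i) = \prod_i chi g (x i).
Proof.
apply: (big_morph (chi g)); [exact: chiDr | exact: chi0r].
Qed.

Local Notation N := (#|{: V}|%:R : R).

Lemma card_rowF2_gt0 : 0 < N.
Proof. by rewrite ltr0n; apply/card_gt0P; exists 0. Qed.

Lemma sum_shift (F : V -> R) a : \sum_x F (x + a) = \sum_x F x.
Proof. by rewrite [RHS](reindex_inj (addIr a)). Qed.

(** If x has a nonzero coordinate i, translating g by the i-th basis vector
    flips the sign of every term. *)
Lemma sum_chi x : \sum_g chi g x = if x == 0 then N else 0.
Proof.
case: eqVneq => [->|x0].
  by rewrite (eq_bigr (fun=> 1)) => [|g _]; rewrite ?chi0r // sumr_const.
have [i xi] : exists i, x 0 i != 0.
  apply/existsP; apply: contra_neqT x0 => /existsPn h.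
  by apply/rowP => i; rewrite mxE; apply/eqP; rewrite -[_ == _]negbK.
have e : chi (delta_mx 0 i) x = -1.
  apply: chi_neq1; rewrite /chi /dot -rowE !mxE.
  by case: (F2_cases (x 0 i)) xi => ->; rewrite ?eqxx // expr1 => _; apply/eqP;
    lra.
have := sum_shift (chi^~ x) (delta_mx 0 i).
under eq_bigr do rewrite chiDl e.
by rewrite -mulr_suml; lra.
Qed.

Definition mean F : R := (\sum_x F x) / N.

Lemma meanZ c F : mean (fun x => c * F x) = c * mean F.
Proof. by rewrite /mean -mulr_sumr mulrA. Qed.

Lemma meanD F G : mean (fun x => F x + G x) = mean F + mean G.
Proof. by rewrite /mean big_split mulrDl. Qed.

Lemma meanB F G : mean (fun x => F x - G x) = mean F - mean G.
Proof. by rewrite /mean sumrB mulrBl. Qed.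

Lemma mean_sum (I : finType) (P : pred I) (F : I -> V -> R) :
  mean (fun x => \sum_(i | P i) F i x) = \sum_(i | P i) mean (F i).
Proof. by rewrite /mean exchange_big /= mulr_suml. Qed.

Lemma mean_cst c : mean (fun=> c) = c.
Proof.
have -> : mean (fun=> c) = c * N / N by rewrite mulr_natr -sumr_const.
by rewrite mulfK // gt_eqF ?card_rowF2_gt0.
Qed.

Lemma eq_mean F G : F =1 G -> mean F = mean G.
Proof. by move=> h; rewrite /mean (eq_bigr G). Qed.

Lemma mean_shift F a : mean (fun x => F (x + a)) = mean F.
Proof. by rewrite /mean sum_shift. Qed.

Lemma mean_exchange (K : V -> V -> R) :
  mean (fun x => mean (K x)) = mean (fun y => mean (K^~ y)).
Proof. by rewrite /mean -!mulr_suml exchange_big. Qed.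

Lemma le_mean F G : (forall x, F x <= G x) -> mean F <= mean G.
Proof. by move=> h; rewrite ler_pM2r ?invr_gt0 ?card_rowF2_gt0 // ler_sum. Qed.

Lemma mean_ge0 F : (forall x, 0 <= F x) -> 0 <= mean F.
Proof. by move=> h; rewrite -(mean_cst 0) le_mean. Qed.

Lemma ler_norm_mean F : `|mean F| <= mean (fun x => `|F x|).
Proof.
by rewrite normrM normfV (gtr0_norm card_rowF2_gt0) // ler_pM2r ?invr_gt0
  ?card_rowF2_gt0 // ler_norm_sum.
Qed.

Definition fourier F g : R := mean (fun x => F x * chi g x).

Lemma fourier0 F : fourier F 0 = mean F.
Proof. by apply: eq_mean => x; rewrite chi0l mulr1. Qed.

Lemma eq_fourier F G : F =1 G -> fourier F =1 fourier G.
Proof. by move=> h g; apply: eq_mean => x; rewrite h. Qed.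

Lemma fourierB F G g :
  fourier (fun x => F x - G x) g = fourier F g - fourier G g.
Proof. by rewrite -meanB; apply: eq_mean => x; rewrite mulrBl. Qed.

Lemma fourierD F G g :
  fourier (fun x => F x + G x) g = fourier F g + fourier G g.
Proof. by rewrite -meanD; apply: eq_mean => x; rewrite mulrDl. Qed.

Lemma fourierZ c F g : fourier (fun x => c * F x) g = c * fourier F g.
Proof. by rewrite -meanZ; apply: eq_mean => x; rewrite mulrA. Qed.

Lemma fourier_norm_le F g : `|fourier F g| <= mean (fun x => `|F x|).
Proof.
apply: le_trans (ler_norm_mean _) _; apply: le_mean => x.
by rewrite normrM normr_chi mulr1.
Qed.

Lemma fourier_inversion F x : F x = \sum_g fourier F g * chi g x.
Proof.
under eq_bigr => g _.
  rewrite /fourier mulrC -meanZ.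
  under eq_mean => y do rewrite mulrCA -chiDr addrC.
  over.
rewrite -mean_sum /mean (bigD1 x) //= -mulr_sumr rowF2_addxx sum_chi eqxx.
rewrite big1 => [|y yx]; last first.
  rewrite -mulr_sumr sum_chi ifF ?mulr0 //.
  by rewrite -[x]rowF2_opp subr_eq0; apply/negbTE.
by rewrite addr0 mulfK // gt_eqF ?card_rowF2_gt0.
Qed.

Lemma parseval F G : mean (fun x => F x * G x) =
  \sum_g fourier F g * fourier G g.
Proof.
under eq_mean => x do rewrite [F x]fourier_inversion mulr_suml.
rewrite mean_sum; apply: eq_bigr => g _.
by rewrite /fourier -meanZ; apply: eq_mean => x; rewrite -/(fourier F g); ring.
Qed.

Lemma parseval_sqr F : mean (fun x => F x ^+ 2) = \sum_g fourier F g ^+ 2.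
Proof. by rewrite -parseval; apply: eq_mean => x; rewrite expr2. Qed.

End Fourier.

(** * Solutions of x_1 + ... + x_k = 0 *)

Section Cycle.
Variables (R : realType) (n k : nat).
Local Notation V := 'rV['F_2]_n.
Local Notation N := (#|{: V}|%:R : R).
Implicit Types (F G : 'I_k -> V -> R).

Definition solutions : {set {ffun 'I_k -> V}} :=
  [set x : {ffun 'I_k -> V} | \sum_i x i == 0].

Definition cycle_density F : R :=
  (\sum_(x in solutions) \prod_i F i (x i)) / #|solutions|%:R.

(** Expanding the product of the coefficients over all k-tuples x leaves the
    character sum over g at x_1 + ... + x_k, which detects solutions. *)
Lemma sum_solutions_fourier F :
  \sum_(x in solutions) \prod_i F i (x i) =
  (\sum_g \prod_i fourier (F i) g) * (N ^+ k / N).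
Proof.
have N0 : N != 0 by rewrite gt_eqF ?card_rowF2_gt0.
have e g : \prod_i fourier (F i) g =
    (\sum_(x : {ffun 'I_k -> V}) (\prod_i F i (x i)) * chi R g (\sum_i x i)) /
      N ^+ k.
  rewrite /fourier /mean big_split /= prodr_const card_ord exprVn;
    congr (_ / _).
  rewrite bigA_distr_bigA /=; apply: eq_bigr => x _.
  by rewrite chi_sum big_split.
under [in RHS]eq_bigr do rewrite e.
rewrite -mulr_suml exchange_big /=.
under [in RHS]eq_bigr do rewrite -mulr_sumr sum_chi.
rewrite [in RHS](bigID (mem solutions)) /= [X in (_ + X) / _]big1 ?addr0 =>
  [|x]; last first.
  by rewrite inE => h; rewrite (negbTE h) mulr0.
rewrite [in RHS](eq_bigr
  (fun x : {ffun 'I_k -> V} => (\prod_i F i (x i)) * N)) => [|x]; last first.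
  by rewrite inE => ->.
by rewrite -mulr_suml; field; rewrite N0 expf_neq0.
Qed.

Lemma fourier1 g : fourier (fun=> 1 : R) g = (g == 0 :> V)%:R.
Proof.
rewrite /fourier /mean; under eq_bigr do rewrite mul1r chiC.
by rewrite sum_chi; case: eqP; rewrite ?mul0r // divff // gt_eqF
  ?card_rowF2_gt0.
Qed.

(** The previous identity for constant functions 1, whose Fourier transform is
    the indicator of 0. *)
Lemma card_solutions : (0 < k)%N -> #|solutions|%:R = N ^+ k / N.
Proof.
move=> k0; have := sum_solutions_fourier (fun _ _ => 1).
have -> : \sum_(x in solutions) \prod_(i < k) 1 = #|solutions|%:R :> R.
  by rewrite -sumr_const; apply: eq_bigr => x _; rewrite big1.
move=> ->.
suff -> : \sum_(g : V) \prod_(i < k) fourier (fun=> 1 : R) g = 1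
  by rewrite mul1r.
rewrite (bigD1 0) //= [X in X + _]big1 => [|i _]; last by rewrite fourier1 eqxx.
rewrite big1 ?addr0 // => g /negbTE g0.
by rewrite (bigD1 (Ordinal k0)) //= fourier1 g0 mul0r.
Qed.

Lemma solutions_gt0 : 0 < #|solutions|%:R :> R.
Proof.
rewrite ltr0n; apply/card_gt0P; exists [ffun=> 0].
by rewrite inE big1 // => i _; rewrite ffunE.
Qed.

Lemma cycle_density_fourier F : (0 < k)%N ->
  cycle_density F = \sum_g \prod_i fourier (F i) g.
Proof.
move=> k0; rewrite /cycle_density sum_solutions_fourier -card_solutions //.
by rewrite mulfK // gt_eqF ?solutions_gt0.
Qed.

Lemma le_cycle_density F G : (forall i x, 0 <= F i x <= G i x) ->
  cycle_density F <= cycle_density G.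
Proof.
move=> h; rewrite ler_pM2r ?invr_gt0 ?solutions_gt0 //.
by apply: ler_sum => x _; apply: ler_prod => i _; apply: h.
Qed.

End Cycle.

(** * Annihilators, cosets and the counting lemma *)

(** Telescoping: replace the factors a i by b i one at a time. *)
Lemma normr_prod_sub_le (R : realType) k (a b : 'I_k -> R) (m d : R) :
  (forall i, `|a i| <= m) -> (forall i, `|b i| <= m) ->
  (forall i, `|a i - b i| <= d) ->
  `|\prod_i a i - \prod_i b i| <= k%:R * d * m ^+ k.-1.
Proof.
elim: k a b => [|k IH] a b am bm abd;
  first by rewrite !big_ord0 subrr normr0 !mul0r.
rewrite !big_ord_recl /=.
set A := \prod_(i < k) a _; set B := \prod_(i < k) b _.
have -> : a ord0 * A - b ord0 * B =
  (a ord0 - b ord0) * A + b ord0 * (A - B) by ring.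
have m0 : 0 <= m := le_trans (normr_ge0 _) (am ord0).
have d0 : 0 <= d := le_trans (normr_ge0 _) (abd ord0).
apply: le_trans (ler_normD _ _) _; rewrite !normrM.
have hA : `|A| <= m ^+ k.
  rewrite normr_prod -[k in _ ^+ k]card_ord -prodr_const.
  by apply: ler_prod => i _; rewrite normr_ge0 am.
have h1 : `|a ord0 - b ord0| * `|A| <= d * m ^+ k by apply: ler_pM.
have h2 : `|b ord0| * `|A - B| <= m * (k%:R * d * m ^+ k.-1).
  by apply: ler_pM => //; apply: IH.
apply: le_trans (lerD h1 h2) _.
case: (k) => [|j] /=; first by rewrite mul0r mul0r mulr0 addr0 mul1r.
by rewrite exprS [in leRHS]mulrS; lra.
Qed.

Section Subgroup.
Variables (R : realType) (n : nat).
Local Notation V := 'rV['F_2]_n.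
Local Notation N := (#|{: V}|%:R : R).
Implicit Types (g x y : V) (S H : {set V}).

Definition annihilator (S : {set V}) : {set V} :=
  [set x | [forall g in S, dot g x == 0]].

(** In characteristic 2, x + y is the difference that tests x in y + H. *)
Definition coset_ind (H : {set V}) y x : R := (x + y \in H)%:R.

Definition density (H : {set V}) : R := mean (coset_ind H 0).

Lemma annihilatorP S x :
  reflect (forall g, g \in S -> dot g x = 0) (x \in annihilator S).
Proof. by rewrite inE; apply: (iffP forall_inP) => h g /h /eqP. Qed.

Lemma annihilator0 S : 0 \in annihilator S.
Proof. by apply/annihilatorP => g _; rewrite dotC /dot mul0mx mxE. Qed.

Lemma annihilatorD S x y :
  x \in annihilator S -> y \in annihilator S -> x + y \in annihilator S.
Proof.
move=> /annihilatorP hx /annihilatorP hy; apply/annihilatorP => g gS.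
by rewrite dotDr hx // hy // addr0.
Qed.

Lemma chi_annihilator S g x : g \in S -> x \in annihilator S -> chi R g x = 1.
Proof. by move=> gS /annihilatorP /(_ g gS) h; rewrite /chi h. Qed.

(** Two points pairing nonzero with the same members of S differ by an element
    of the annihilator, so each of the at most 2 ^ #|S| classes has no more
    elements than the annihilator. *)
Lemma card_annihilator S : (#|{: V}| <= 2 ^ #|S| * #|annihilator S|)%N.
Proof.
pose sig x := [set g in S | dot g x != 0].
rewrite -[leqLHS]sum1_card (partition_big sig (mem (powerset S))) /=;
  last first.
  by move=> x _; rewrite powersetE; apply/subsetP => g; rewrite inE => /andP[].
rewrite -card_powerset -sum_nat_const; apply: leq_sum => T _.
rewrite sum1_card; case: (pickP (fun x => sig x == T)) => [x0 /eqP x0T|h];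
  last first.
  by rewrite eq_card0 // => x; rewrite unfold_in /= h.
rewrite -(card_imset _ (addIr x0)); apply: subset_leq_card.
apply/subsetP => _ /imsetP[x sx ->]; have /eqP xT : sig x == T := sx.
apply/annihilatorP => g gS; rewrite dotDr.
have : (g \in sig x) = (g \in sig x0) by rewrite xT x0T.
rewrite !inE gS /=.
by case: (F2_cases (dot g x)) => ->; case: (F2_cases (dot g x0)) => -> //= _;
  rewrite F2_addxx.
Qed.

Lemma densityE H : density H = #|H|%:R / N.
Proof.
rewrite /density /mean; congr (_ / _).
under eq_bigr do rewrite /coset_ind addr0.
by rewrite -sumr_const [RHS]big_mkcond; apply: eq_bigr => x _; case: ifP.
Qed.

Lemma density_annihilator S : 2^-1 ^+ #|S| <= density (annihilator S).
Proof.
rewrite densityE ler_pdivlMr ?card_rowF2_gt0 // exprVn mulrC ler_pdivrMr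
  ?exprn_gt0 //.
by rewrite mulrC -natrX -natrM ler_nat card_annihilator.
Qed.

Variable H : {set V}.
Hypothesis H0 : 0 \in H.
Hypothesis HD : forall x y, x \in H -> y \in H -> x + y \in H.
Local Notation mu := (density H).

Lemma mem_addr h x : h \in H -> (x + h \in H) = (x \in H).
Proof.
move=> hH; apply/idP/idP => [xh|xH]; last exact: HD.
by have := HD xh hH; rewrite -addrA rowF2_addxx addr0.
Qed.

Lemma coset_indD h y x : h \in H -> coset_ind H y (x + h) = coset_ind H y x.
Proof. by move=> hH; rewrite /coset_ind addrAC (mem_addr _ hH). Qed.

Lemma coset_ind_sqr y x : coset_ind H y x ^+ 2 = coset_ind H y x.
Proof. by rewrite /coset_ind; case: (_ \in _); rewrite ?expr1n ?expr0n. Qed.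

Lemma coset_ind_ge0 y x : 0 <= coset_ind H y x.
Proof. exact: ler0n. Qed.

Lemma coset_ind_le1 y x : coset_ind H y x <= 1.
Proof. by rewrite /coset_ind; case: (_ \in _); rewrite ?ler01. Qed.

Lemma density_gt0 : 0 < mu.
Proof.
rewrite densityE divr_gt0 ?card_rowF2_gt0 // ltr0n; apply/card_gt0P;
  by exists 0.
Qed.

Lemma mean_coset y : mean (coset_ind H y) = mu.
Proof.
rewrite -(mean_shift _ y); apply: eq_mean => x.
by rewrite /coset_ind -addrA rowF2_addxx.
Qed.

Lemma fourier_coset y g :
  fourier (coset_ind H y) g = chi R g y * fourier (coset_ind H 0) g.
Proof.
rewrite /fourier -(mean_shift _ y) -meanZ; apply: eq_mean => x.
by rewrite /coset_ind -addrA rowF2_addxx chiDr; ring.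
Qed.

(** A character that is not 1 on all of H takes the value -1 at some h in H,
    and translating by h shows that the coefficient equals its opposite. *)
Lemma fourier_subgroup g :
  fourier (coset_ind H 0) g = 0 \/ fourier (coset_ind H 0) g = mu.
Proof.
have [/forall_inP h|] := boolP [forall h in H, chi R g h == 1].
  right; apply: eq_mean => x; rewrite /coset_ind addr0.
  by case: (boolP (x \in H)) => [xH|_]; rewrite ?mul0r // (eqP (h x xH)) mulr1.
rewrite negb_forall => /existsP[h]; rewrite negb_imply => /andP[hH /chi_neq1 e].
left; suff : fourier (coset_ind H 0) g = - fourier (coset_ind H 0) g by lra.
rewrite [LHS](_ : _ = mean (fun x => -1 * (coset_ind H 0 x * chi R g x)));
  last first.
  by rewrite /fourier -(mean_shift _ h); apply: eq_mean => x;
    rewrite coset_indD // chiDr e; ring.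
by rewrite meanZ mulN1r.
Qed.

Lemma fourier_coset_norm_le y g : `|fourier (coset_ind H y) g| <= mu.
Proof.
apply: le_trans (fourier_norm_le _ _) _; rewrite -(mean_coset y);
  apply: le_mean => x.
by rewrite ger0_norm ?coset_ind_ge0.
Qed.

Lemma sum_fourier_coset_sqr y : \sum_g fourier (coset_ind H y) g ^+ 2 = mu.
Proof.
rewrite -parseval_sqr -(mean_coset y); apply: eq_mean => x;
  exact: coset_ind_sqr.
Qed.

(** Every coefficient is 0 or mu, so higher powers reduce to Parseval. *)
Lemma sum_fourier_subgroup_expr m :
  \sum_g fourier (coset_ind H 0) g ^+ m.+2 = mu ^+ m.+1.
Proof.
rewrite exprS -[X in X * _](sum_fourier_coset_sqr 0) mulr_suml;
  apply: eq_bigr => g _.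
have [->|->] := fourier_subgroup g; rewrite ?expr0n ?mul0r //.
by rewrite -exprD addnC addn2.
Qed.

(** The absolute coefficients are 0 or mu and their squares sum to mu. This L1
    bound lets a globally small Fourier transform stay small after restriction
    to a coset, with no loss depending on H. *)
Lemma sum_fourier_coset_norm y : \sum_g `|fourier (coset_ind H y) g| = 1.
Proof.
apply: (mulIf (lt0r_neq0 density_gt0)); rewrite mul1r mulr_suml.
rewrite -[RHS](sum_fourier_coset_sqr 0); apply: eq_bigr => g _.
rewrite fourier_coset normrM normr_chi mul1r.
have [->|->] := fourier_subgroup g; first by rewrite normr0 mul0r expr0n.
by rewrite gtr0_norm ?density_gt0.
Qed.

Lemma sum_fourier_mul_coset_sqr_le (F : V -> R) y : (forall x, 0 <= F x <= 1) ->
  \sum_g fourier (fun x => F x * coset_ind H y x) g ^+ 2 <= mu.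
Proof.
move=> F01; rewrite -parseval_sqr -(mean_coset y); apply: le_mean => x.
have /andP[F0 F1] := F01 x.
rewrite exprMn coset_ind_sqr ler_piMl ?coset_ind_ge0 //.
by rewrite expr_le1.
Qed.

(** The density of solutions inside the cosets is compared, character by
    character, with the same quantity for the functions c_i times the
    indicator of the i-th coset, which is exactly the product of the c_i times
    mu^(k-1). In each product of k coefficients one factor is a difference at
    most kappa mu, k - 3 factors are at most mu, and the remaining two are
    summed over g by Parseval. *)
Lemma coset_counting k (F : 'I_k -> V -> R) (y : 'I_k -> V) (c : 'I_k -> R)
    (theta kappa : R) :
  (3 <= k)%N -> \sum_i y i = 0 ->
  (forall i x, 0 <= F i x <= 1) ->
  0 <= theta -> (forall i, theta <= c i <= 1) ->
  (forall i g,
    `|fourier (fun x => (F i x - c i) * coset_ind H (y i) x) g| <= kappa * mu) ->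
  (theta ^+ k - 2 * k%:R ^+ 2 * kappa) * mu ^+ k.-1 <= cycle_density F.
Proof.
move=> k3 y0 F01 th0 thc hF.
have k0 : (0 < k)%N by exact: leq_trans k3.
have mu0 := density_gt0.
have kap0 : 0 <= kappa.
  by rewrite -(pmulr_lge0 _ mu0);
    apply: le_trans (normr_ge0 _) (hF (Ordinal k0) 0).
pose W i := coset_ind H (y i).
pose a i g := fourier (fun x => F i x * W i x) g.
pose b i g := fourier (fun x => c i * W i x) g.
have c0 i : 0 <= c i by have /andP[h _] := thc i; exact: le_trans h.
have c1 i : c i <= 1 by have /andP[] := thc i.
have amu i g : `|a i g| <= mu.
  apply: le_trans (fourier_norm_le _ _) _; rewrite -(mean_coset (y i));
    apply: le_mean => x.
  have /andP[h0 h1] := F01 i x.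
  by rewrite normrM !ger0_norm ?coset_ind_ge0 // ler_piMl ?coset_ind_ge0.
have bmu i g : `|b i g| <= mu.
  rewrite /b fourierZ normrM ger0_norm //.
  apply: le_trans (fourier_coset_norm_le (y i) g).
  by rewrite ler_piMl.
have abk i g : `|a i g - b i g| <= kappa * mu.
  rewrite -fourierB; apply: le_trans (hF i g).
  by rewrite (eq_fourier (G := fun x => (F i x - c i) * W i x)) // => x;
    rewrite mulrBl.
pose Q g := \sum_i (a i g ^+ 2 + b i g ^+ 2).
have Qge i g : a i g ^+ 2 + b i g ^+ 2 <= Q g.
  rewrite /Q (bigD1 i) //= lerDl sumr_ge0 // => j _.
  by rewrite addr_ge0 // sqr_ge0.
have Q0 g : 0 <= Q g by rewrite sumr_ge0 // => j _; rewrite addr_ge0 // sqr_ge0.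
have SQ : \sum_g Q g <= 2 * k%:R * mu.
  rewrite exchange_big /=.
  apply: le_trans (_ : \sum_(i < k) (2 * mu) <= _); last first.
    by rewrite sumr_const card_ord -mulr_natr; lra.
  apply: ler_sum => i _; rewrite big_split /=.
  have h1 : \sum_g a i g ^+ 2 <= mu :=
    sum_fourier_mul_coset_sqr_le (y i) (F01 i).
  have h2 : \sum_g b i g ^+ 2 <= mu.
    by apply: (@sum_fourier_mul_coset_sqr_le (fun=> c i)) => x; rewrite c0 c1.
  by lra.
(* Q g dominates every squared coefficient at g, and its sum is at most 2 k
   mu: it carries the two factors spent on Parseval. *)
have key g : \prod_i b i g - k%:R * (kappa * mu) * (mu ^+ (k - 3) * Q g) <=
  \prod_i a i g.
  (* One bound m serves all coefficients at g; k - 3 copies of it are used as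
     mu and two as a square root of Q g. *)
  pose m := Num.min mu (Num.sqrt (Q g)).
  have m0 : 0 <= m by rewrite le_min ltW //= sqrtr_ge0.
  have mmu : m <= mu by rewrite ge_min lexx.
  have mQ : m ^+ 2 <= Q g.
    rewrite -[leRHS]sqr_sqrtr // ler_pXn2r ?nnegrE ?sqrtr_ge0 //.
    by rewrite ge_min lexx orbT.
  have am i : `|a i g| <= m.
    rewrite le_min amu -sqrtr_sqr ler_sqrt //.
    by apply: le_trans (Qge i g); rewrite lerDl sqr_ge0.
  have bm i : `|b i g| <= m.
    rewrite le_min bmu -sqrtr_sqr ler_sqrt //.
    by apply: le_trans (Qge i g); rewrite lerDr sqr_ge0.
  have := normr_prod_sub_le am bm (abk^~ g).
  have hm : m ^+ k.-1 <= mu ^+ (k - 3) * Q g.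
    have -> : k.-1 = (k - 3 + 2)%N by lia.
    by rewrite exprD ler_pM ?exprn_ge0 // lerXn2r // nnegrE ltW.
  have : k%:R * (kappa * mu) * m ^+ k.-1 <=
    k%:R * (kappa * mu) * (mu ^+ (k - 3) * Q g).
    by rewrite ler_wpM2l // mulr_ge0 // mulr_ge0 // ltW.
  by rewrite ler_norml => h1 /andP[h2 _]; lra.
have main : \sum_g \prod_i b i g = (\prod_i c i) * mu ^+ k.-1.
  have -> : k.-1 = (k - 2).+1 by lia.
  rewrite -sum_fourier_subgroup_expr mulr_sumr; apply: eq_bigr => g _.
  under eq_bigr do rewrite /b fourierZ fourier_coset.
  rewrite big_split big_split /= -chi_sum y0 chi0r mul1r prodr_const card_ord.
  by congr (_ * _ ^+ _); lia.
have cge : theta ^+ k <= \prod_i c i.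
  rewrite -[k in _ ^+ k]card_ord -prodr_const; apply: ler_prod => i _.
  by rewrite th0; have /andP[] := thc i.
apply: le_trans (_ : \sum_g \prod_i a i g <= _); last first.
  rewrite -cycle_density_fourier //; apply: le_cycle_density => i x.
  have /andP[h0 h1] := F01 i x.
  by rewrite mulr_ge0 ?coset_ind_ge0 //= ler_piMr // coset_ind_le1.
apply: le_trans (_ : \sum_g (\prod_i b i g - k%:R * (kappa * mu) * (mu ^+ (k -
  3) * Q g)) <= _); last first.
  by apply: ler_sum => g _; exact: key.
rewrite sumrB main -!mulr_sumr mulrBl; apply: lerB.
  by rewrite ler_wpM2r // exprn_ge0 // ltW.
have -> : 2 * k%:R ^+ 2 * kappa * mu ^+ k.-1 =
  k%:R * (kappa * mu) * (mu ^+ (k - 3) * (2 * k%:R * mu)).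
  have -> : k.-1 = (k - 3 + 2)%N by lia.
  by rewrite exprD; ring.
apply: ler_wpM2l; first by rewrite mulr_ge0 // mulr_ge0 // ltW.
by apply: ler_wpM2l => //; rewrite exprn_ge0 // ltW.
Qed.

End Subgroup.

(** * The arithmetic regularity lemma *)

Section Spectrum.
Variables (R : realType) (n : nat).
Local Notation V := 'rV['F_2]_n.
Implicit Types (F G : V -> R) (g h x y : V) (S H : {set V}).

Definition fourier_part F S x : R := \sum_(g in S) fourier F g * chi R g x.

Lemma fourier_fourier_part F S h :
  fourier (fourier_part F S) h = if h \in S then fourier F h else 0.
Proof.
rewrite /fourier_part {1}/fourier; under eq_mean => x do rewrite mulr_suml.
rewrite mean_sum.
have e g : mean (fun x => fourier F g * chi R g x * chi R h x) =
  fourier F g * (g == h)%:R.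
  have -> : (g == h) = (g + h == 0) by rewrite addr_eq0 rowF2_opp.
  rewrite -fourier1 /fourier -meanZ; apply: eq_mean => x.
  by rewrite chiDl -/(fourier F g); ring.
under eq_bigr do rewrite e.
case: ifP => hS.
  rewrite (bigD1 h) //= eqxx mulr1 big1 ?addr0 // => g /andP[_ /negbTE ->].
  by rewrite mulr0.
rewrite big1 // => g gS; case: eqP => [gh|]; last by rewrite mulr0.
by rewrite -gh gS in hS.
Qed.

Lemma mean_fourier_part_sqr F S :
  mean (fun x => fourier_part F S x ^+ 2) = \sum_(g in S) fourier F g ^+ 2.
Proof.
rewrite parseval_sqr [RHS]big_mkcond; apply: eq_bigr => g _.
by rewrite fourier_fourier_part; case: ifP => //; rewrite expr0n.
Qed.

Lemma sub_fourier_part F S x :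
  F x - fourier_part F S x = fourier_part F (~: S) x.
Proof.
rewrite {1}[F x]fourier_inversion (bigID (mem S)) /= /fourier_part addrAC subrr
  add0r.
by apply: eq_bigl => g; rewrite inE.
Qed.

Lemma fourier_part_invariant F S x h :
  h \in annihilator S -> fourier_part F S (x + h) = fourier_part F S x.
Proof.
move=> hS; apply: eq_bigr => g gS.
by rewrite chiDr (chi_annihilator _ gS hS) mulr1.
Qed.

Lemma sum_fourier_sqr_le1 F : (forall x, 0 <= F x <= 1) ->
  \sum_g fourier F g ^+ 2 <= 1.
Proof.
move=> F01; rewrite -parseval_sqr -[leRHS](mean_cst n 1); apply: le_mean => x.
by have /andP[h0 h1] := F01 x; rewrite expr_le1.
Qed.

Definition large_spectrum F (t : R) : {set V} := [set g | t <= `|fourier F g|].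

(** At most t^-2 coefficients of a function with values in [0, 1] can be t or
    larger, so this is a lower bound for the density of the annihilator of its
    large spectrum; it does not involve n. *)
Definition bohr_density (t : R) : R := 2^-1 ^+ Num.bound (t ^- 2).

Lemma bohr_density_gt0 t : 0 < bohr_density t.
Proof. by rewrite exprn_gt0 // invr_gt0. Qed.

Lemma density_large_spectrum F t : 0 < t -> (forall x, 0 <= F x <= 1) ->
  bohr_density t <= density R (annihilator (large_spectrum F t)).
Proof.
move=> t0 F01; apply: le_trans (density_annihilator _ _).
rewrite ler_wiXn2l ?invr_ge0 ?invf_le1 ?ler1n // ltnW // -(ltr_nat R).
apply: le_lt_trans (archi_boundP _); last by rewrite invr_ge0 exprn_ge0 // ltW.
rewrite -[leRHS]mul1r ler_pdivlMr ?exprn_gt0 //.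
apply: le_trans (sum_fourier_sqr_le1 F01).
rewrite (bigID (mem (large_spectrum F t))) /=.
rewrite -[leLHS]addr0 lerD ?sumr_ge0 // => [|g _]; last exact: sqr_ge0.
rewrite mulr_natl -sumr_const; apply: ler_sum => g; rewrite inE => tg.
by rewrite -[leRHS]real_normK ?num_real // lerXn2r ?nnegrE ?normr_ge0 ?(ltW t0).
Qed.

(** Exchange the two averages: psi y = psi x whenever x + y lies in H, and each
    x lies in cosets y + H for a proportion [density R H] of all y. *)
Lemma mean_mean_coset F (psi : V -> R) H : 0 \in H ->
  (forall x h, h \in H -> psi (x + h) = psi x) ->
  mean (fun y => psi y * mean (fun x => F x * coset_ind R H y x)) =
  mean (fun x => F x * psi x) * density R H.
Proof.
move=> H0 psiH.
transitivity (mean (fun y => mean (fun x => F x * psi x * coset_ind R H x y))).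
  apply: eq_mean => y; rewrite -meanZ; apply: eq_mean => x.
  rewrite /coset_ind (addrC y x); case: (boolP (x + y \in H)) => [xyH|_];
    last by rewrite !mulr0.
  by rewrite -(psiH x _ xyH) addrA rowF2_addxx add0r; ring.
rewrite mean_exchange mulrC -meanZ; apply: eq_mean => x.
by rewrite meanZ mean_coset mulrC.
Qed.

End Spectrum.

(** The energy pigeonhole: J increments larger than d would carry the sequence
    from nonnegative values beyond 1. *)
Lemma small_increment (R : realType) (e : nat -> R) (d : R) (J : nat) :
  0 <= e 0%N -> e J <= 1 -> 0 < d -> 1 <= J%:R * d ->
  exists2 j, (j < J)%N & e j.+1 - e j <= d.
Proof.
move=> e0 eJ d0 Jd; apply: contrapT => h.
have lower j : (j <= J)%N -> (0 < j)%N -> j%:R * d < e j.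
  elim: j => // j IH jJ _.
  have inc : d < e j.+1 - e j.
    by rewrite ltNge; apply/negP => le; apply: h; exists j.
  case: (posnP j) => [j0|jpos].
    by move: inc; rewrite j0 mul1r; lra.
  have := IH (ltnW jJ) jpos; rewrite -[j.+1]addn1 natrD.
  by move: inc; rewrite -addn1; lra.
case: (posnP J) => [J0|Jpos]; first by move: Jd; rewrite J0 mul0r; lra.
by have := lower J (leqnn J) Jpos; lra.
Qed.

Section Regularity.
Variables (R : realType).

Section Uniform.
Variables (n : nat).
Local Notation V := 'rV['F_2]_n.
Implicit Types (F G : V -> R) (g h x y : V) (S H : {set V}).

Definition coset_mean F H y : R :=
  mean (fun x => F x * coset_ind R H y x) / density R H.

(** The hypothesis of [coset_counting] on a single coset, with the coset mean as
    the constant. *)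
Definition uniform F H (kappa : R) y : bool :=
  [forall g,
    `|fourier (fun x => (F x - coset_mean F H y) * coset_ind R H y x) g|
      <= kappa * density R H].

Lemma coset_ind_base H x y h :
  (forall x y, x \in H -> y \in H -> x + y \in H) ->
  h \in H -> coset_ind R H (y + h) x = coset_ind R H y x.
Proof. by move=> HD hH; rewrite /coset_ind addrA (mem_addr HD _ hH). Qed.

Lemma coset_mean_invariant F H y h :
  (forall x y, x \in H -> y \in H -> x + y \in H) ->
  h \in H -> coset_mean F H (y + h) = coset_mean F H y.
Proof.
move=> HD hH; congr (_ / _); apply: eq_mean => x; by rewrite coset_ind_base.
Qed.

Lemma coset_mean_le1 F H y : 0 \in H -> (forall x, 0 <= F x <= 1) ->
  coset_mean F H y <= 1.
Proof.
move=> H0 F01; rewrite ler_pdivrMr ?density_gt0 // mul1r -(mean_coset R H y).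
apply: le_mean => x; have /andP[h0 h1] := F01 x.
by rewrite ler_piMl // coset_ind_ge0.
Qed.

(** The part f1, small in L2 on the coset, contributes at most its L1 norm
    there. The part f2, with globally small coefficients, is multiplied by the
    coset indicator, hence its transform is convolved with one of L1 norm 1
    and stays below t. The constant c need not be the coset mean, but the
    coefficient at 0 shows that it is close to it. *)
Lemma uniform_of_split F H (kappa t c : R) (f1 f2 : V -> R) y :
  0 \in H -> (forall x y, x \in H -> y \in H -> x + y \in H) ->
  0 < kappa -> t <= kappa / 4 * density R H ->
  (forall x, x + y \in H -> F x - c = f1 x + f2 x) ->
  mean (fun x => f1 x ^+ 2 * coset_ind R H y x) <=
    kappa ^+ 2 / 16 * density R H ->
  (forall g, `|fourier f2 g| <= t) ->
  uniform F H kappa y.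
Proof.
move=> H0 HD kap0 tk split12 hf1 hf2.
have mu0 := density_gt0 R H0.
set mu := density R H in tk hf1 mu0 *.
pose W := coset_ind R H y.
have b1 g : `|fourier (fun x => f1 x * W x) g| <= kappa / 4 * mu.
  apply: le_trans (fourier_norm_le _ _) _.
  apply: le_trans (_ : mean (fun x =>
    kappa / 8 * W x + 2 / kappa * (f1 x ^+ 2 * W x)) <= _).
    apply: le_mean => x; rewrite normrM [X in _ * X]ger0_norm ?coset_ind_ge0 //
      mulrA -mulrDl.
    rewrite ler_wpM2r ?coset_ind_ge0 // -[f1 x ^+ 2]real_normK ?num_real //.
    (* The inequality u <= kappa / 8 + (2 / kappa) u^2, by completing the
       square, turns the L2 bound into an L1 bound without square roots. *)
    set u := `|f1 x|; rewrite -subr_ge0.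
    have -> : kappa / 8 + 2 / kappa * u ^+ 2 - u =
      2 / kappa * (u - kappa / 4) ^+ 2.
      by field; rewrite gt_eqF.
    by rewrite mulr_ge0 ?sqr_ge0 // divr_ge0 // ltW.
  rewrite meanD !meanZ mean_coset -/mu.
  have : 2 / kappa * mean (fun x => f1 x ^+ 2 * W x) <=
    2 / kappa * (kappa ^+ 2 / 16 * mu).
    by rewrite ler_wpM2l // divr_ge0 // ltW.
  have -> : 2 / kappa * (kappa ^+ 2 / 16 * mu) = kappa / 8 * mu by field;
    rewrite gt_eqF.
  by lra.
have b2 g : `|fourier (fun x => f2 x * W x) g| <= kappa / 4 * mu.
  apply: le_trans tk.
  have -> : fourier (fun x => f2 x * W x) g =
    \sum_h fourier f2 h * fourier W (h + g).
    rewrite /fourier.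
    under eq_mean => x do rewrite [f2 x]fourier_inversion !mulr_suml.
    rewrite mean_sum; apply: eq_bigr => h _; rewrite -meanZ;
      apply: eq_mean => x.
    by rewrite chiDl -/(fourier f2 h); ring.
  apply: le_trans (ler_norm_sum _ _ _) _.
  have -> : t = \sum_h t * `|fourier W (h + g)|.
    by rewrite -mulr_sumr (sum_shift (fun h => `|fourier W h|))
      sum_fourier_coset_norm // mulr1.
  apply: ler_sum => h _; rewrite normrM ler_wpM2r //.
have b0 g : `|fourier (fun x => (F x - c) * W x) g| <= kappa / 2 * mu.
  have -> : fourier (fun x => (F x - c) * W x) g =
     fourier (fun x => f1 x * W x) g + fourier (fun x => f2 x * W x) g.
    rewrite -fourierD; apply: eq_fourier => x; rewrite /W /coset_ind -mulrDl.
    by case: (boolP (x + y \in H)) => [/split12 ->|]; rewrite ?mulr0.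
  apply: le_trans (ler_normD _ _) _.
  by have := b1 g; have := b2 g; lra.
have bc : `|coset_mean F H y - c| <= kappa / 2.
  rewrite -(ler_pM2r mu0) -[X in _ * X <= _](gtr0_norm mu0) -normrM.
  apply: le_trans (b0 0); rewrite fourier0.
  under [in leRHS]eq_mean do rewrite mulrBl.
  by rewrite meanB meanZ mean_coset mulrBl divfK // gt_eqF.
apply/forallP => g; rewrite -/mu.
have -> : fourier (fun x => (F x - coset_mean F H y) * coset_ind R H y x) g =
   fourier (fun x => (F x - c) * W x) g - (coset_mean F H y - c) * fourier W g.
  by rewrite -fourierZ -fourierB; apply: eq_fourier => x; rewrite /W; ring.
apply: le_trans (ler_normB _ _) _; rewrite [X in _ + X]normrM.
have hW : `|fourier W g| <= mu by exact: fourier_coset_norm_le.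
have := ler_pM (normr_ge0 _) (normr_ge0 _) bc hW.
by have := b0 g; lra.
Qed.

End Uniform.

(** Each threshold is small compared with the density of the annihilator of
    the spectrum above the previous one. *)
Fixpoint threshold (kappa : R) (j : nat) : R :=
  if j is j'.+1 then
    Num.min (threshold kappa j') (kappa / 4 * bohr_density (threshold kappa j'))
  else 1.

Lemma threshold_gt0 kappa j : 0 < kappa -> 0 < threshold kappa j.
Proof.
move=> k0; elim: j => [|j IH] /=; first exact: ltr01.
by rewrite lt_min IH mulr_gt0 ?bohr_density_gt0 // divr_gt0.
Qed.

Lemma threshold_le kappa i j : (i <= j)%N ->
  threshold kappa j <= threshold kappa i.
Proof.
move=> /subnK <-; elim: (j - i)%N => // m IH.
by rewrite addSn /= ge_min IH.
Qed.

(** Let S_j be the set of characters with coefficient at least the j-th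
    threshold. The energies of F on the increasing sets S_j lie in [0, 1], so
    for some j the characters of S_(j+1) outside S_j carry little energy. With
    H the annihilator of S_j, the part of F on S_j is constant on cosets of H,
    the part on S_(j+1) outside S_j is small in L2, hence small on most cosets
    by Markov's inequality, and the remaining coefficients are tiny compared
    with the density of H. Thus [uniform_of_split] applies on most cosets. *)
Lemma regularity (kappa : R) : 0 < kappa ->
  exists2 m : R, 0 < m &
    forall n (F : 'rV['F_2]_n -> R), (forall x, 0 <= F x <= 1) ->
    exists S : {set 'rV['F_2]_n},
      m <= density R (annihilator S) /\
      mean (fun y => (~~ uniform F (annihilator S) kappa y)%:R) <= kappa.
Proof.
move=> kap0.
(* Markov's inequality at level kappa^2 / 16 turns energy d into exceptional
   measure kappa. *)
pose d := kappa ^+ 3 / 16; pose J := Num.bound d^-1.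
have d0 : 0 < d by rewrite divr_gt0 // exprn_gt0.
exists (4 / kappa * threshold kappa J) => [|n F F01].
  by rewrite mulr_gt0 ?threshold_gt0 // divr_gt0.
pose S j := large_spectrum F (threshold kappa j).
pose e j := \sum_(g in S j) fourier F g ^+ 2.
have [||||j jJ inc] := @small_increment R e d J.
- by apply: sumr_ge0 => g _; exact: sqr_ge0.
- apply: le_trans (sum_fourier_sqr_le1 F01);
  rewrite [leRHS](bigID (mem (S J))) /=.
  by rewrite lerDl sumr_ge0 // => g _; exact: sqr_ge0.
- by [].
- rewrite -ler_pdivrMr // mul1r ltW // archi_boundP // invr_ge0 ltW //.
exists (S j); set H := annihilator (S j).
have H0 : 0 \in H := annihilator0 _.
have HD : forall x y, x \in H -> y \in H -> x + y \in H by move=> *;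
  exact: annihilatorD.
have mu0 := density_gt0 R H0.
have t0 := threshold_gt0 j kap0.
have tmu : threshold kappa j.+1 <= kappa / 4 * density R H.
  rewrite /= ge_min; apply/orP; right.
  apply: ler_wpM2l; first by rewrite divr_ge0 // ltW.
  exact: density_large_spectrum.
split.
  have := threshold_le kappa jJ.
  have -> : density R H = 4 / kappa * (kappa / 4 * density R H).
    by field; rewrite gt_eqF.
  move=> h; apply: ler_wpM2l; first by rewrite divr_ge0 // ltW.
  exact: le_trans tmu.
pose T := S j.+1 :\: S j.
have sSS : S j \subset S j.+1.
  apply/subsetP => g; rewrite !inE; apply: le_trans; exact: threshold_le.
pose f1 := fourier_part F T; pose f2 := fourier_part F (~: S j.+1).
pose beta y := mean (fun x => f1 x ^+ 2 * coset_ind R H y x).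
have uni y : beta y <= kappa ^+ 2 / 16 * density R H -> uniform F H kappa y.
  move=> hb; apply: (@uniform_of_split n F H kappa (threshold kappa j.+1)
    (fourier_part F (S j) y) f1 f2) => //.
    move=> x xyH; rewrite -(@fourier_part_invariant _ _ F (S j) y (x + y)) //.
    rewrite addrCA rowF2_addxx addr0 sub_fourier_part /f1 /f2 /fourier_part.
    rewrite (bigID (mem (S j.+1))) /=; congr (_ + _); apply: eq_bigl => g;
      rewrite !inE.
      by rewrite andbC.
    have := subsetP sSS g; rewrite !inE => ss.
    by apply/andP/idP => [[]//|nh]; split=> //; exact: contra ss nh.
  move=> g; rewrite fourier_fourier_part !inE; case: ifP;
    rewrite ?normr0 ?(ltW (threshold_gt0 _ _)) //.
  by rewrite -ltNge => /ltW.
pose B := kappa ^+ 2 / 16 * density R H.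
have B0 : 0 < B by rewrite mulr_gt0 // divr_gt0 // exprn_gt0.
rewrite -(ler_pM2l B0) -meanZ.
apply: le_trans (_ : mean beta <= _).
  apply: le_mean => y; have b0 : 0 <= beta y.
    by apply: mean_ge0 => x; rewrite mulr_ge0 ?sqr_ge0 ?coset_ind_ge0.
  case: (boolP (uniform F H kappa y)) => [_|nu] /=; first by rewrite mulr0.
  by rewrite mulr1 leNgt; apply: contra nu => /ltW /uni.
have -> : mean beta = mean (fun x => f1 x ^+ 2) * density R H.
  have := @mean_mean_coset R n (fun x => f1 x ^+ 2) (fun=> 1) H H0
    (fun _ _ _ => erefl).
  under eq_mean do rewrite mul1r.
  by move=> ->; congr (_ * _); apply: eq_mean => x; rewrite mulr1.
rewrite mean_fourier_part_sqr.
have -> : \sum_(g in T) fourier F g ^+ 2 = e j.+1 - e j.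
  rewrite /e [\sum_(g in S j.+1) _](big_setID (S j)) /= (setIidPr sSS).
  by rewrite addrC addrK.
have -> : B * kappa = d * density R H by rewrite /B /d; ring.
by rewrite ler_wpM2r // ltW.
Qed.

End Regularity.

(** * The removal lemma *)

Section Removal.
Variables (R : realType) (k : nat) (k3 : (3 <= k)%N).
Implicit Types (Sigma : 'rV['F_2]_k).

Lemma solution_last n (x : {ffun 'I_k -> 'rV['F_2]_n}) (i : 'I_k) :
  x \in solutions n k -> ~~ (i < k.-1)%N ->
  x i = \sum_(j < k | (j < k.-1)%N) x j.
Proof.
rewrite inE (bigID (fun j : 'I_k => (j < k.-1)%N)) /= => /eqP h il.
rewrite [X in _ + X](big_pred1 i) in h; last first.
  by move=> j /=; apply/idP/eqP => [jl|-> //]; apply/val_inj => /=;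
    have := ltn_ord j; have := ltn_ord i; lia.
by apply/eqP; rewrite eq_sym -subr_eq0 rowF2_opp h.
Qed.

(** A linear map can send the first k - 1 basis vectors anywhere; the last of
    the k vectors is their sum, that is, all k images sum to 0. *)
Lemma cycle_freeP n Sigma (f : 'rV['F_2]_n -> 'F_2) :
  cycle_free Sigma f <->
  forall x : {ffun 'I_k -> 'rV['F_2]_n}, x \in solutions n k ->
    ~ (forall i, f (x i) = Sigma 0 i).
Proof.
split=> [free x xS fx|free L LS].
  apply: (free (mulmxr (\matrix_i x i))); apply/rowP => i; rewrite mxE -fx;
    congr f.
  have e j : delta_mx 0 j *m (\matrix_i x i) = x j by rewrite -rowE rowK.
  rewrite /= /cycle_vec; case: ifPn => il; first exact: e.
  by rewrite mulmx_suml (solution_last xS il); apply: eq_bigr => j _; exact: e.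
apply: (free [ffun i => L (cycle_vec i)]).
  rewrite inE; under eq_bigr do rewrite ffunE.
  have kk : (k.-1 < k)%N by lia.
  rewrite (bigID (fun j : 'I_k => (j < k.-1)%N)) /=.
  rewrite [X in _ + X](big_pred1 (Ordinal kk)); last first.
    by move=> j /=; apply/idP/eqP => [jl|-> /=]; [apply/val_inj => /=;
      have := ltn_ord j|]; lia.
  rewrite [cycle_vec (Ordinal kk)]/cycle_vec /= ltnn linear_sum /=.
  under eq_bigr => j jl do rewrite /cycle_vec jl.
  by rewrite rowF2_addxx.
by move=> i; rewrite ffunE -LS mxE.
Qed.

Definition pattern_ind n Sigma (f : 'rV['F_2]_n -> 'F_2) (i : 'I_k) x : R :=
  (f x == Sigma 0 i)%:R.

Lemma pattern_ind01 n Sigma (f : 'rV['F_2]_n -> 'F_2) i x :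
  0 <= pattern_ind Sigma f i x <= 1.
Proof. by rewrite /pattern_ind; case: eqP => _; rewrite ?lexx ?ler01. Qed.

Lemma pattern_density n Sigma (f : 'rV['F_2]_n -> 'F_2) :
  cycle_density (pattern_ind Sigma f) =
  (\sum_(x in solutions n k) [forall i, f (x i) == Sigma 0 i]%:R) /
    #|solutions n k|%:R.
Proof.
congr (_ / _); apply: eq_bigr => x _; rewrite /pattern_ind.
case: (boolP [forall _, _]) => [/forallP h|/forallPn [i h]].
  by rewrite big1 // => i _; rewrite h.
by rewrite (bigD1 i) //= (negbTE h) mul0r.
Qed.

Lemma fdistE n (f g : 'rV['F_2]_n -> 'F_2) :
  fdist R f g = mean (fun x => (f x != g x)%:R).
Proof.
rewrite /fdist /mean; congr (_ / _).
rewrite -sum1_card natr_sum big_mkcond; apply: eq_bigr => x _.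
by rewrite inE; case: eqP.
Qed.

Definition removal_property Sigma : Prop :=
  forall eps : R, 0 < eps -> exists2 tau : R, 0 < tau &
    forall n (f : 'rV['F_2]_n -> 'F_2),
      far_from eps (@cycle_free k n Sigma) f ->
      tau <= cycle_density (pattern_ind Sigma f).

(** Flipping creates no new occurrence of b, so a solution found after
    flipping consists of points where f equals b, in uniform cosets where b
    has density at least theta; the counting lemma with the coset means as
    constants then bounds the solution density of f from below. *)
Lemma removal_constant Sigma (b : 'F_2) : (forall i, Sigma 0 i = b) ->
  removal_property Sigma.
Proof.
move=> Sb eps0 eps0_gt0.
pose eps := Num.min eps0 1.
have eps_gt0 : 0 < eps by rewrite lt_min eps0_gt0 ltr01.
have eps_le1 : eps <= 1 by rewrite ge_min lexx orbT.
have eps_le : eps <= eps0 by rewrite ge_min lexx.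
pose theta := eps / 4.
have theta0 : 0 < theta by rewrite divr_gt0.
have theta1 : theta <= 1 by rewrite /theta; lra.
have k0 : 0 < k%:R :> R by rewrite ltr0n; lia.
have k1 : 1 <= k%:R :> R by rewrite ler1n; lia.
(* The loss 2 k^2 kappa in the counting lemma is then theta^k / 2. *)
pose kappa := theta ^+ k / (4 * k%:R ^+ 2).
have kappa0 : 0 < kappa by rewrite divr_gt0 ?exprn_gt0 // mulr_gt0 // exprn_gt0.
have kappa_theta : kappa <= theta.
  rewrite ler_pdivrMr ?mulr_gt0 ?exprn_gt0 //.
  apply: le_trans (_ : theta * 1 <= _).
    by rewrite mulr1 -[leRHS]expr1 ler_wiXn2l // ?ltW //; lia.
  rewrite ler_wpM2l ?(ltW theta0) //.
  have : 1 <= k%:R ^+ 2 :> R by rewrite exprn_ege1.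
  by lra.
have [m m0 reg] := regularity kappa0.
exists (theta ^+ k / 2 * m ^+ k.-1) => [|n f far].
  by rewrite mulr_gt0 ?exprn_gt0 // divr_gt0 // exprn_gt0.
pose F x : R := (f x == b)%:R.
have F01 x : 0 <= F x <= 1 by rewrite /F; case: eqP => _; rewrite ?lexx ?ler01.
have [S [mS unifS]] := reg n F F01.
set H := annihilator S in mS unifS.
have H0 : 0 \in H := annihilator0 _.
have HD : forall x y, x \in H -> y \in H -> x + y \in H by move=> *;
  exact: annihilatorD.
have mu0 := density_gt0 R H0.
pose keep x := uniform F H kappa x && (theta <= coset_mean F H x).
pose f' x := if (f x == b) && ~~ keep x then b + 1 else f x.
have b1 : b + 1 != b by rewrite -subr_eq0 addrC addKr oner_eq0.
have f'b x : f' x = b -> f x = b /\ keep x.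
  rewrite /f'; case: (eqVneq (f x) b) => [fb|fb] /=; last by move=> h;
    rewrite h eqxx in fb.
  by case: (keep x) => //= h; rewrite h eqxx in b1.
(* The flipped points lie in the non-uniform cosets, of measure at most kappa,
   or are the points with f = b in cosets where those have density below
   theta. *)
have close : fdist R f f' < eps0.
  pose psi x : R := (coset_mean F H x < theta)%R%:R.
  have psiH x h : h \in H -> psi (x + h) = psi x.
    by move=> hH; rewrite /psi coset_mean_invariant.
  rewrite fdistE; apply: le_lt_trans (_ : kappa + theta < _); last first.
    by move: kappa_theta eps_le; rewrite /theta; lra.
  apply: le_trans (_ : mean (fun x =>
    (~~ uniform F H kappa x)%:R + F x * psi x) <= _).
    apply: le_mean => x; rewrite /f' /F /psi /keep ltNge.
    case: (f x == b) => /=; last by rewrite eqxx mul0r addr0 ler0n.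
    rewrite mul1r; case: (uniform _ _ _ _) => /=; last first.
      by rewrite -[leLHS]addr0 lerD ?lern1 ?leq_b1 // ler0n.
    by rewrite add0r; case: (theta <= _) => /=; rewrite ?eqxx // ler_nat leq_b1.
  rewrite meanD lerD // -(ler_pM2r mu0) -mean_mean_coset // -[leRHS](mean_cst
    n).
  apply: le_mean => y; rewrite /psi; case: ltP => h /=; last first.
    by rewrite mul0r mulr_ge0 // ltW.
  by rewrite mul1r -ler_pdivrMr // ltW.
have [/far|nf] := pselect (cycle_free Sigma f'); first by rewrite leNgt close.
suff [y yS fy] : exists2 y : {ffun 'I_k -> 'rV['F_2]_n}, y \in solutions n k &
    forall i, f' (y i) = b.
  apply: le_trans (_ : (theta ^+ k - 2 * k%:R ^+ 2 * kappa) * density R H ^+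
    k.-1 <= _).
    have -> : theta ^+ k - 2 * k%:R ^+ 2 * kappa = theta ^+ k / 2.
      by rewrite /kappa; field; rewrite gt_eqF.
    rewrite ler_wpM2l ?divr_ge0 ?exprn_ge0 ?(ltW theta0) //.
    by rewrite lerXn2r ?nnegrE ?(ltW m0) ?(ltW mu0).
  apply: (@coset_counting R n H H0 HD k _ y
    (fun i => coset_mean F H (y i))) => //.
  - by move: yS; rewrite inE => /eqP.
  - by move=> i x; exact: pattern_ind01.
  - exact: ltW.
  - move=> i; have [_ /andP[_ ->]] := f'b _ (fy i); exact: coset_mean_le1.
  - move=> i g; have [_ /andP[/forallP /(_ g) h _]] := f'b _ (fy i).
    rewrite (eq_fourier (G := fun x =>
      (F x - coset_mean F H (y i)) * coset_ind R H (y i) x)) //.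
    by move=> x; rewrite /pattern_ind Sb.
apply: contrapT => h; apply: nf; apply/cycle_freeP => y yS fy; apply: h;
  exists y => // i.
by rewrite fy Sb.
Qed.

Lemma half_sqr (w : R) : 2^-1 <= w -> 1 <= 4 * w ^+ 2.
Proof. by move=> h; nra. Qed.

(** Nonnegativity of the factors at the positions other than i, j, l makes the
    product P g of their coefficients at most P 0 in absolute value, and P 0
    is at least eps ^+ k because neither value of f is rare. *)
Lemma removal_mixed Sigma (i j l : 'I_k) : i != j ->
  Sigma 0 i = Sigma 0 j -> Sigma 0 l != Sigma 0 i -> removal_property Sigma.
Proof.
move=> ij Sij Sl eps0 eps0_gt0.
pose b := Sigma 0 i; have Si : Sigma 0 i = b by [];
  have Sj : Sigma 0 j = b by rewrite -Sij.
have Sl1 : Sigma 0 l = b + 1.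
  by apply/eqP; rewrite -F2_neqE.
pose eps := Num.min eps0 1.
have eps_gt0 : 0 < eps by rewrite lt_min eps0_gt0 ltr01.
have eps_le1 : eps <= 1 by rewrite ge_min lexx orbT.
have eps_le : eps <= eps0 by rewrite ge_min lexx.
have b1 : b + 1 != b by rewrite -subr_eq0 addrC addKr oner_eq0.
have k1 : 1 <= k%:R :> R by rewrite ler1n; lia.
pose t := eps / 2; have t0 : 0 < t by rewrite divr_gt0.
pose m := bohr_density t; have m0 : 0 < m := bohr_density_gt0 t.
(* The loss 2 k^2 kappa in the counting lemma is then 1/2. *)
pose kappa : R := 1 / (4 * k%:R ^+ 2).
have kappa0 : 0 < kappa by rewrite divr_gt0 // mulr_gt0 // exprn_gt0 //; lra.
pose tau1 := Num.min eps (kappa * m) * eps ^+ k.+1 / 16.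
pose tau := Num.min tau1 (m ^+ k.-1 / 2).
have tau1_gt0 : 0 < tau1.
  by rewrite divr_gt0 // mulr_gt0 ?exprn_gt0 // lt_min eps_gt0 mulr_gt0.
exists tau => [|n f far]; first by rewrite lt_min tau1_gt0 divr_gt0 //
  exprn_gt0.
rewrite leNgt; apply/negP; set Lam := cycle_density _;
  rewrite lt_min => /andP[small1 small2].
have not_close g : cycle_free Sigma g -> eps <= fdist R f g.
  by move=> /far; exact: le_trans.
pose F x : R := (f x == b)%:R.
have F01 x : 0 <= F x <= 1 by rewrite /F; case: eqP => _; rewrite ?lexx ?ler01.
pose G x : R := 1 - F x.
have GE x : G x = (f x == b + 1)%:R.
  by rewrite /G /F -F2_neqE; case: eqP => _; rewrite ?subrr ?subr0.
have meanF : eps <= mean F.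
  have free1 : cycle_free Sigma (fun _ : 'rV['F_2]_n => b + 1).
    by apply/cycle_freeP => x _ /(_ i); rewrite Si => /eqP; rewrite (negbTE b1).
  apply: le_trans (not_close _ free1) _; rewrite fdistE le_eqVlt; apply/orP;
    left.
  by apply/eqP/eq_mean => x; rewrite /F -F2_neqE negbK.
have meanG : eps <= mean G.
  have free0 : cycle_free Sigma (fun _ : 'rV['F_2]_n => b).
    by apply/cycle_freeP => x _ /(_ l); rewrite Sl1 => /esym/eqP;
      rewrite (negbTE b1).
  apply: le_trans (not_close _ free0) _; rewrite fdistE le_eqVlt; apply/orP;
    left.
  by apply/eqP/eq_mean => x; rewrite /G /F; case: eqP => _ /=;
    rewrite ?subrr ?subr0.
have normF g : `|fourier F g| <= mean F.
  apply: le_trans (fourier_norm_le _ _) _; apply: le_mean => x.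
  by have /andP[h _] := F01 x; rewrite ger0_norm.
have sumF : \sum_g fourier F g ^+ 2 = mean F.
  rewrite -parseval_sqr; apply: eq_mean => x.
  by rewrite /F; case: eqP => _; rewrite ?expr1n ?expr0n.
pose a := mean F.
pose others r := [&& r != i, r != j & r != l].
pose P g := \prod_(r < k | others r) fourier (pattern_ind Sigma f r) g.
have li : l != i by apply: contraNneq Sl => ->.
have lj : l != j by apply: contraNneq Sl => ->; rewrite Sij.
have patS r : Sigma 0 r = b -> fourier (pattern_ind Sigma f r) =1 fourier F.
  by move=> e; apply: eq_fourier => x; rewrite /pattern_ind e.
have patG : fourier (pattern_ind Sigma f l) =1 fourier G.
  by apply: eq_fourier => x; rewrite /pattern_ind Sl1 GE.
have fourG g : fourier G g = (g == 0)%:R - fourier F g.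
  by rewrite -fourier1 -fourierB; apply: eq_fourier.
have prodE g : \prod_r fourier (pattern_ind Sigma f r) g =
    fourier F g ^+ 2 * ((g == 0)%:R - fourier F g) * P g.
  have ji : j != i by rewrite eq_sym.
  rewrite (bigD1 i) //= (bigD1 j) //= (bigD1 l) ?li ?lj //=.
  rewrite (patS i) // (patS j) // patG fourG expr2.
  rewrite (eq_bigl others) => [|r]; last by rewrite /others andbA.
  by rewrite -/(P g); move: (fourier F g) (P g) => u v; ring.
have P0 : eps ^+ k <= P 0.
  rewrite /P big_mkcond -[k in _ ^+ k]card_ord -prodr_const;
    apply: ler_prod => r _.
  rewrite ltW //=; case: (others r) => //; rewrite fourier0.
  have [e|] := eqVneq (Sigma 0 r) b;
    first by rewrite -fourier0 patS // fourier0.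
  rewrite F2_neqE => /eqP e.
  by rewrite (eq_mean (G := G)) // => x; rewrite GE /pattern_ind e.
have PP0 g : `|P g| <= P 0.
  rewrite normr_prod; apply: ler_prod => r _; rewrite normr_ge0 /= fourier0.
  apply: le_trans (fourier_norm_le _ _) _; apply: le_mean => x.
  by have /andP[h _] := pattern_ind01 Sigma f r x; rewrite ger0_norm.
have p0 : 0 <= P 0 by apply: le_trans P0; rewrite exprn_ge0 // ltW.
pose Gam := large_spectrum F t.
pose rho := \sum_(g in ~: Gam) fourier F g ^+ 2.
(* Write A(g) for the coefficients of F and 1_0 for the indicator of g = 0.
   The solution density is the sum of A(g)^2 (1_0(g) - A(g)) P g. The term 1_0
   contributes a^2 P 0, which is the sum of A(g)^2 a P 0 because F is an
   indicator; so the density is at least P 0 times the sum of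
   A(g)^2 (a - |A(g)|), and off the large spectrum the bracket is at least
   eps / 2. *)
have rho_le : P 0 * (eps / 2 * rho) <= Lam.
  rewrite /Lam cycle_density_fourier ?(ltnW (ltnW k3)) //.
  under [leRHS]eq_bigr do rewrite prodE.
  apply: le_trans (_ : \sum_g fourier F g ^+ 2 * (a - `|fourier F g|) * P 0 <=
    _).
    rewrite -mulr_suml [leLHS]mulrC; apply: ler_wpM2r => //.
    rewrite [leRHS](bigID (mem (~: Gam))) /= mulr_sumr -[leLHS]addr0;
      apply: lerD.
      apply: ler_sum => g; rewrite !inE -ltNge /t => gt.
      by rewrite mulrC ler_wpM2l ?sqr_ge0 //; move: meanF; rewrite -/a; lra.
    by apply: sumr_ge0 => g _; rewrite mulr_ge0 ?sqr_ge0 // subr_ge0.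
  apply: le_trans (_ : \sum_g (fourier F g ^+ 2 * (g == 0)%:R * P g -
    fourier F g ^+ 2 * `|fourier F g| * P 0) <= _).
    rewrite le_eqVlt; apply/orP; left; apply/eqP; rewrite sumrB.
    under eq_bigr do rewrite mulrBr mulrBl.
    rewrite sumrB; congr (_ - _); rewrite -!mulr_suml sumF [RHS](bigD1 0) //=
      eqxx mulr1 fourier0.
    rewrite big1 ?addr0 => [|g /negbTE ->]; last by rewrite mulr0 mul0r.
    by rewrite expr2.
  apply: ler_sum => g _.
  have FP : fourier F g * P g <= `|fourier F g| * P 0.
    by apply: le_trans (ler_norm _) _; rewrite (normrM (fourier F g)) ler_wpM2l.
  have := ler_wpM2l (sqr_ge0 (fourier F g)) FP.
  by move: (fourier F g) (P g) (P 0) (_%:R) => u v w z; lra.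
have rho0 : 0 <= rho by apply: sumr_ge0 => g _; exact: sqr_ge0.
have rho_small : 4 * rho < Num.min eps (kappa * m).
  set M := Num.min _ _ in small1 *.
  have h1 : eps ^+ k * (eps / 2 * rho) <= P 0 * (eps / 2 * rho).
    by apply: ler_wpM2r => //; rewrite mulr_ge0 // divr_ge0 // ltW.
  have h2 : eps ^+ k * (eps / 2 * rho) < M * eps ^+ k.+1 / 16.
    by apply: le_lt_trans small1; exact: le_trans rho_le.
  have e1 : eps ^+ k * (eps / 2 * rho) =
    (rho / 2) * eps ^+ k.+1 by rewrite exprS; ring.
  have e2 : M * eps ^+ k.+1 / 16 = (M / 16) * eps ^+ k.+1 by ring.
  have h3 : rho / 2 < M / 16 by rewrite -(ltr_pM2r (exprn_gt0 k.+1 eps_gt0))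
    -e1 -e2.
  by lra.
pose q := fourier_part F Gam.
(* Rounding: wherever f and g differ, F and q differ by at least 1/2. *)
pose g x := if 2^-1 < q x then b else b + 1.
have fg : fdist R f g <= 4 * rho.
  rewrite fdistE /rho -mean_fourier_part_sqr -meanZ; apply: le_mean => x.
  rewrite -sub_fourier_part -/(q x) /g.
  have := sqr_ge0 (F x - q x).
  case: ltP => hq.
    case: (boolP (f x == b)) => /= fx; first by lra.
    have -> : F x = 0 by rewrite /F (negbTE fx).
    by rewrite sub0r sqrrN => _; apply: half_sqr; exact: ltW.
  case: (boolP (f x == b + 1)) => /= fx; first by lra.
  have -> : F x = 1 by move: fx; rewrite /F -F2_neqE negbK => ->.
  by move=> _; apply: half_sqr; lra.
move: rho_small; rewrite lt_min => /andP[rho_eps rho_km].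
have [/not_close|nf] := pselect (cycle_free Sigma g); first by lra.
pose H := annihilator Gam.
have H0 : 0 \in H := annihilator0 _.
have HD : forall x y, x \in H -> y \in H -> x + y \in H by move=> *;
  exact: annihilatorD.
have mu0 := density_gt0 R H0.
have mH : m <= density R H by exact: density_large_spectrum.
have gH x h : h \in H -> g (x + h) = g x.
  by move=> hH; rewrite /g /q fourier_part_invariant.
apply: nf; apply/cycle_freeP => y yS gy.
have : (1 ^+ k - 2 * k%:R ^+ 2 * kappa) * density R H ^+ k.-1 <= Lam.
  apply: (@coset_counting R n H H0 HD k _ y (fun=> 1)) => //.
  - by move: yS; rewrite inE => /eqP.
  - by move=> r x; exact: pattern_ind01.
  - by move=> r; rewrite !lexx.
  move=> r gam; apply: le_trans (fourier_norm_le _ _) _.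
  apply: le_trans (_ : fdist R f g <= _).
    rewrite fdistE; apply: le_mean => x; rewrite /coset_ind.
    case: (boolP (x + y r \in H)) => [xyH|_];
      last by rewrite mulr0 normr0 ler0n.
    have -> : g x = Sigma 0 r by rewrite -gy -(gH (y r) _ xyH) addrCA
      rowF2_addxx addr0.
    rewrite mulr1 /pattern_ind; case: (_ == _) => /=;
      first by rewrite subrr normr0.
    by rewrite sub0r normrN normr1.
  apply: le_trans fg _; apply: le_trans (ltW rho_km) _.
  by rewrite ler_wpM2l // ltW.
have -> : 1 ^+ k - 2 * k%:R ^+ 2 * kappa = 2^-1.
  by rewrite expr1n /kappa; field; rewrite gt_eqF //; lra.
have : m ^+ k.-1 <= density R H ^+ k.-1 by rewrite lerXn2r ?nnegrE ?(ltW m0)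
  ?(ltW mu0).
by move: small2; lra.
Qed.

(** Among three positions two carry the same value. *)
Lemma removal Sigma : removal_property Sigma.
Proof.
pose i0 : 'I_k := Ordinal (leq_trans (isT : (0 < 3)%N) k3).
pose i1 : 'I_k := Ordinal (leq_trans (isT : (1 < 3)%N) k3).
pose i2 : 'I_k := Ordinal (leq_trans (isT : (2 < 3)%N) k3).
have [/forallP const|/forallPn [l Sl]] :=
  boolP [forall i, Sigma 0 i == Sigma 0 i0].
  by apply: (@removal_constant _ (Sigma 0 i0)) => i; exact/eqP.
have mono (i j : 'I_k) : i != j -> Sigma 0 i = Sigma 0 j ->
  removal_property Sigma.
  move=> ij Sij; have [e|ne] := eqVneq (Sigma 0 i) (Sigma 0 i0).
    by apply: (@removal_mixed _ i j l) => //; rewrite e.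
  by apply: (@removal_mixed _ i j i0) => //; rewrite eq_sym.
have [e|n01] := eqVneq (Sigma 0 i0) (Sigma 0 i1); first exact: (mono i0 i1).
have [e|n02] := eqVneq (Sigma 0 i0) (Sigma 0 i2); first exact: (mono i0 i2).
apply: (mono i1 i2) => //.
move: n01 n02; case: (F2_cases (Sigma 0 i0)) => ->;
  case: (F2_cases (Sigma 0 i1)) => ->;
  by case: (F2_cases (Sigma 0 i2)) => ->; rewrite ?eqxx.
Qed.

End Removal.

(** * The tester *)

Section Tester.
Variables (R : realType) (k : nat) (Sigma : 'rV['F_2]_k).

Fixpoint match_strategy n (s : seq ('rV['F_2]_n * 'F_2)) : strategy n :=
  if s is (x, b) :: s' then
    Query x (fun c => if c == b then match_strategy s' else Verdict n true)
  else Verdict n false.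

Lemma run_match_strategy n (f : 'rV['F_2]_n -> 'F_2) s :
  run f (match_strategy s) = ~~ all (fun p => f p.1 == p.2) s.
Proof. by elim: s => [|[x b] s IH] //=; case: eqP. Qed.

Lemma num_queries_match_strategy n (f : 'rV['F_2]_n -> 'F_2) s :
  (num_queries f (match_strategy s) <= size s)%N.
Proof. by elim: s => [|[x b] s IH] //=; case: eqP. Qed.

Definition cycle_strategy n (x : {ffun 'I_k -> 'rV['F_2]_n}) : strategy n :=
  match_strategy [seq (x i, Sigma 0 i) | i <- enum 'I_k].

Lemma run_cycle_strategy n (f : 'rV['F_2]_n -> 'F_2) x :
  run f (cycle_strategy x) = ~~ [forall i, f (x i) == Sigma 0 i].
Proof.
rewrite run_match_strategy all_map; congr (~~ _).
apply/allP/forallP => h i; first by apply: h; rewrite mem_enum.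
by move=> _; exact: h.
Qed.

Definition uniform_solution n (x : {ffun 'I_k -> 'rV['F_2]_n}) : R :=
  (x \in solutions n k)%:R / #|solutions n k|%:R.

Lemma uniform_solution_ge0 n (x : {ffun 'I_k -> 'rV['F_2]_n}) :
  0 <= uniform_solution x.
Proof. by rewrite divr_ge0. Qed.

Lemma uniform_solution_sum1 n :
  \sum_(x : {ffun 'I_k -> 'rV['F_2]_n}) uniform_solution x = 1.
Proof.
rewrite -mulr_suml -natr_sum -big_mkcond sum1_card divff // gt_eqF //.
exact: solutions_gt0.
Qed.

Lemma cycle_strategy_queries n (x : {ffun 'I_k -> 'rV['F_2]_n}) f :
  (num_queries f (cycle_strategy x) <= k)%N.
Proof.
apply: leq_trans (num_queries_match_strategy _ _) _.
by rewrite size_map size_enum_ord.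
Qed.

Definition cycle_tester n : tester R k n :=
  Tester (@uniform_solution_ge0 n) (uniform_solution_sum1 n)
    (@cycle_strategy_queries n).

Lemma reject_cycle_tester n (f : 'rV['F_2]_n -> 'F_2) :
  reject_prob (cycle_tester n) f = cycle_density (@pattern_ind R k n Sigma f).
Proof.
rewrite pattern_density mulr_suml [RHS]big_mkcond [LHS]big_mkcond;
  apply: eq_bigr => x _.
rewrite /= run_cycle_strategy negbK /uniform_solution.
by case: (x \in _); case: [forall _, _]; rewrite ?mul0r.
Qed.

Lemma accept_cycle_tester n (f : 'rV['F_2]_n -> 'F_2) :
  accept_prob (cycle_tester n) f = 1 - reject_prob (cycle_tester n) f.
Proof.
apply/eqP; rewrite eq_sym subr_eq eq_sym -(prob_sum1 (cycle_tester n));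
  apply/eqP.
by rewrite [RHS](bigID (fun c => run f (strategy_of (cycle_tester n) c))).
Qed.

End Tester.

Theorem theorem2p2 (R : realType) (k : nat) (hk : (3 <= k)%N)
    (Sigma : 'rV['F_2]_k) :
  exists (tau : R -> R) (T : forall n : nat, tester R k n),
    (forall eps : R, 0 < eps -> 0 < tau eps) /\
    forall n : nat, (0 < n)%N -> forall f : 'rV['F_2]_n -> 'F_2,
      (cycle_free Sigma f -> accept_prob (T n) f = 1) /\
      (forall eps : R, 0 < eps -> far_from eps (@cycle_free k n Sigma) f ->
         tau eps <= reject_prob (T n) f).
Proof.
have /choice[tau tauP] : forall eps : R, exists tau : R, 0 < eps -> 0 < tau /\
    forall n (f : 'rV['F_2]_n -> 'F_2),
      far_from eps (@cycle_free k n Sigma) f ->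
      tau <= cycle_density (@pattern_ind R k n Sigma f).
  move=> eps; have [e0|_] := ltP 0 eps; last by exists 0.
  by have [tau t0 h] := removal hk Sigma e0; exists tau.
exists tau, (cycle_tester R Sigma); split=> [eps e0|n _ f];
  first by have [] := tauP eps e0.
split=> [/(cycle_freeP hk) free|eps e0 far].
  rewrite accept_cycle_tester reject_cycle_tester pattern_density big1 ?mul0r
    ?subr0 // => x xS.
  case: forallP => // h; case: (free x xS) => i; exact/eqP.
by rewrite reject_cycle_tester; apply: (tauP eps e0).2.
Qed.
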